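(* Let $D$ be a random variable with values in $\{1,2,\dots\}$, let $\beta\ge0$ and $B\in\mathbb R$, and consider the annealed Ising model on the configuration model with $n$ vertices whose degrees are i.i.d. copies of $D$. Then its annealed pressure satisfies $\psi_n^{\rm an,D}(\beta,B)=\infty$ if and only if $$\mathbb E\big[e^{\beta D/2}\big]=\infty.$$
   Context: Configuration model with i.i.d. degrees: let $D_1,\dots,D_n$ be i.i.d. copies of $D$ (if $\sum_iD_i$ is odd, $D_n$ is increased by 1). Given the degrees, attach $D_i$ half-edges to each vertex $i\in[n]=\{1,\dots,n\}$ and pair all half-edges uniformly at random; each pair forms an edge. The result is a random multigraph (self-loops and multiple edges allowed) with edge multiset $E_n$. Ising model: $$Z_n(\beta,B)=\sum_{\sigma\in\{-1,+1\}^n}\exp\Big\{\beta\sum_{(i,j)\in E_n}\sigma_i\sigma_j+B\sum_{i\in[n]}\sigma_i\Big\},$$ where edges are counted with multiplicity and a self-loop at $i$ contributes $\sigma_i\sigma_i=1$. The annealed pressure is $\psi_n^{\rm an,D}(\beta,B)=\frac1n\log\mathbb E[Z_n(\beta,B)]$, where $\mathbb E$ is the expectation over both the degrees and the uniform pairing. *)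

(* Defs.v *)
From mathcomp Require Export all_boot all_order all_algebra.
From mathcomp Require Export all_classical all_reals all_analysis.

Set Implicit Arguments.
Unset Strict Implicit.
Unset Printing Implicit Defensive.

Import Order.TTheory GRing.Theory Num.Theory.

Local Open Scope classical_set_scope.
Local Open Scope ring_scope.

(* Taking A i = setT shows that it makes no difference whether the product rule
   is required for all subfamilies J or only for the full one. *)
Definition mutually_independent (d d' : measure_display) (T : measurableType d)
    (T' : measurableType d') (R : realType) (P : probability T R) (I : finType)
    (X : I -> {RV P >-> T'}) : Prop :=
  forall (J : {set I}) (A : I -> set T'), (forall i, measurable (A i)) ->
    P [set t | forall i, i \in J -> A i (X i t)] =
    (\prod_(i in J) P (X i @^-1` A i))%E.

(* D and its copies are allowed to live on different probability spaces. *)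
Definition iid_copies (d0 d d' : measure_display) (T0 : measurableType d0)
    (T : measurableType d) (T' : measurableType d') (R : realType)
    (P0 : probability T0 R) (P : probability T R) (I : finType)
    (D : {RV P0 >-> T'}) (X : I -> {RV P >-> T'}) : Prop :=
  mutually_independent X /\
  forall (i : I) (A : set T'), measurable A ->
    distribution P (X i) A = distribution P0 D A.

(* Number of half-edges at each vertex: the last vertex (n - 1 in 'I_n)
   receives an additional one when the sum of the degrees is odd. *)
Definition adjusted_degree (n : nat) (d : {ffun 'I_n -> nat}) (i : 'I_n) : nat :=
  (d i + (odd (\sum_(j < n) d j) && (i.+1 == n)))%N.

Definition half_edge (n : nat) (d : {ffun 'I_n -> nat}) : finType :=
  {i : 'I_n & 'I_(adjusted_degree d i)}.

Definition is_pairing (H : finType) (m : {set {set H}}) : bool :=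
  finset.partition m [set: H]%SET && [forall e in m, #|e| == 2%N].

Definition pairing (n : nat) (d : {ffun 'I_n -> nat}) : finType :=
  {m : {set {set half_edge d}} | is_pairing m}.

(* The edge multiset: each pair of half-edges gives the list of its two end
   vertices, so that a self-loop at i is [:: i; i]. *)
Definition edges (n : nat) (d : {ffun 'I_n -> nat}) (m : pairing d) :
    seq (seq 'I_n) :=
  [seq [seq tag h | h <- enum e] | e : {set half_edge d} <- enum (val m)].

Definition degrees (d : measure_display) (T : measurableType d) (R : realType)
    (P : probability T R) (n : nat) (Deg : 'I_n -> {RV P >-> nat}) (t : T) :
    {ffun 'I_n -> nat} :=
  [ffun i => Deg i t].

(* Conditionally on the degrees, M is uniform over all pairings of the
   half-edges.  As the type of M t depends on the degrees, the joint event
   "degrees = dg and M = m" is an equality in {dg & pairing dg}. *)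
Definition uniform_pairing (d : measure_display) (T : measurableType d)
    (R : realType) (P : probability T R) (n : nat)
    (Deg : 'I_n -> {RV P >-> nat}) (M : forall t : T, pairing (degrees Deg t)) :
    Prop :=
  forall (dg : {ffun 'I_n -> nat}) (m : pairing dg),
    let A := [set t | existT (@pairing n) (degrees Deg t) (M t) =
                      existT (@pairing n) dg m] in
    measurable A /\
    P A = (P [set t | degrees Deg t = dg] * (#|pairing dg|%:R^-1)%:E)%E.

(* Spin configurations in {-1, +1}^n are encoded as {ffun 'I_n -> bool}. *)
Definition spin (R : realType) (n : nat) (s : {ffun 'I_n -> bool}) (i : 'I_n) :
    R :=
  if s i then 1 else -1.

Definition ising_Z (R : realType) (n : nat) (E : seq (seq 'I_n)) (beta B : R) :
    R :=
  \sum_(s : {ffun 'I_n -> bool})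
    expR (beta * (\sum_(e <- E) \prod_(i <- e) spin R s i) +
          B * (\sum_(i < n) spin R s i)).

Definition annealed_pressure (d : measure_display) (T : measurableType d)
    (R : realType) (P : probability T R) (n : nat)
    (Deg : 'I_n -> {RV P >-> nat}) (M : forall t : T, pairing (degrees Deg t))
    (beta B : R) : \bar R :=
  ((n%:R^-1)%:E * lne ('E_P[fun t => ising_Z (edges (M t)) beta B]))%E.

(* Main.v *)
(* A pairing has sum_i D_i / 2 edges, up to 1/2.  The energy of a configuration
   is maximal when all spins agree, so Z_n equals exp (beta * sum_i D_i / 2) up
   to factors depending only on n, beta and B, whatever the pairing is.  The
   expectation of this exponential is E[e^(beta D / 2)]^n by independence.  Of
   this identity only two consequences are needed: the upper bound, obtained by
   truncating the degrees so that all expectations become finite sums, and the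
   lower bound by a single factor, the other ones being at least 1. *)
Require Import Defs.
From mathcomp Require Import measurable_realfun lra.

Set Implicit Arguments.
Unset Strict Implicit.
Unset Printing Implicit Defensive.

Import Order.TTheory GRing.Theory Num.Theory.

Local Open Scope classical_set_scope.
Local Open Scope ring_scope.

(** * Deterministic bounds on the partition function *)

Section IsingBounds.
Variables (R : realType) (n : nat).

(** The blocks of a pairing are pairs that partition the half-edges, so doubling their number counts
    all half-edges. *)
Lemma size_edges (n_gt0 : (0 < n)%N) (d : {ffun 'I_n -> nat}) (m : pairing d) :
  (size (edges m) * 2 =
   \sum_(i < n) d i + odd (\sum_(i < n) d i))%N.
Proof.
case/andP: (valP m) => m_part /forall_inP m_card2.
rewrite size_map -cardE.
have /esym -> : (#|[set: half_edge d]%SET| = #|val m| * 2)%N.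
  by apply: card_uniform_partition m_part => e /m_card2/eqP.
rewrite cardsT card_tagged sumnE big_map big_enum /=.
under eq_bigr do rewrite card_ord.
rewrite big_split /=; congr (_ + _)%N; move: (odd _) => b.
(* The parity bit [b] is added at a single vertex, the one of index [n.-1], so it is counted
   once. *)
have last_lt : (n.-1 < n)%N by rewrite prednK.
rewrite (bigD1 (Ordinal last_lt)) //= prednK // eqxx andbT big1 ?addn0 //.
move=> i; rewrite -val_eqE /= => i_neq.
by rewrite -[X in _ == X](prednK n_gt0) eqSS (negbTE i_neq) andbF.
Qed.

Lemma normr_spin (s : {ffun 'I_n -> bool}) i : `|spin R s i| = 1.
Proof. by rewrite /spin; case: ifP; rewrite ?normrN1 ?normr1. Qed.

(** All spin products have absolute value 1, so each term is at most the exponential with every edge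
    satisfied and the field term replaced by its absolute bound. *)
Lemma ising_Z_le (E : seq (seq 'I_n)) (beta B : R) : 0 <= beta ->
  ising_Z E beta B <=
  #|{ffun 'I_n -> bool}|%:R * expR (beta * (size E)%:R + `|B| * n%:R).
Proof.
move=> beta_ge0; rewrite mulr_natl -sumr_const ler_sum // => s _.
rewrite ler_expR lerD //.
  rewrite ler_wpM2l // -sum1_size natr_sum ler_sum // => e _.
  rewrite (le_trans (ler_norm _)) // normr_prod big1 // => i _.
  exact: normr_spin.
rewrite (le_trans (ler_norm _)) // normrM ler_wpM2l //.
rewrite (le_trans (ler_norm_sum _ _ _)) //.
by under eq_bigr do rewrite normr_spin; rewrite sumr_const card_ord.
Qed.

(** The all-plus configuration alone gives this, since the other terms are nonnegative. *)
Lemma ising_Z_ge (E : seq (seq 'I_n)) (beta B : R) :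
  expR (beta * (size E)%:R - `|B| * n%:R) <= ising_Z E beta B.
Proof.
pose s : {ffun 'I_n -> bool} := [ffun=> true].
have s1 i : spin R s i = 1 by rewrite /spin ffunE.
rewrite /ising_Z (bigD1 s) //=.
apply: ler_wpDr; first by apply: sumr_ge0 => *; exact: expR_ge0.
rewrite ler_expR lerD //.
  under eq_bigr do under eq_bigr do rewrite s1.
  under eq_bigr do rewrite big1_eq.
  by rewrite -sum1_size natr_sum.
under eq_bigr do rewrite s1.
by rewrite sumr_const card_ord -mulNr ler_wpM2r // lerNnormlW.
Qed.

End IsingBounds.

(** * Measurability and expectation of discrete functions *)

Lemma measurable_countable_fibers d (T : measurableType d) (S : countType)
    (f : T -> S) d' (U : measurableType d') (g : S -> U) :
  (forall s, measurable (f @^-1` [set s])) -> measurable_fun setT (g \o f).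
Proof.
move=> mf _ Y _; rewrite setTI.
(* As [S] is countable, any preimage is a countable union of fibres of [f], so [S] needs no
   sigma-algebra of its own. *)
have -> : (g \o f) @^-1` Y = \bigcup_s (f @^-1` ([set s] `&` g @^-1` Y)).
  apply/seteqP; split => [t Yt|t [s _ [/= -> //]]].
  by exists (f t).
apply: countable_bigcupT_measurable => [|s]; first exact: countableP.
have [Ygs|nYgs] := pselect (Y (g s)).
  rewrite (_ : _ `&` _ = [set s]) //; apply/seteqP; split => [x []//|x ->].
  by split.
rewrite (_ : _ `&` _ = set0) ?preimage_set0 //.
by apply/seteqP; split => x //= [-> ].
Qed.

Lemma expectation_integral d (T : measurableType d) (R : realType)
    (P : probability T R) (X : T -> R) :
  ('E_P[X] = \int[P]_t (X t)%:E)%E.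
Proof. by rewrite unlock. Qed.

Lemma measurable_nat_comp d (T : measurableType d) (R : realType)
    (P : probability T R) (X : {RV P >-> nat}) (f : nat -> R) : measurable_fun setT (f \o X).
Proof. by apply: measurableT_comp => // _ A _. Qed.

Lemma expectation_sum_indic d (T : measurableType d) (R : realType)
    (P : probability T R) (J : finType) (a : J -> R) (A : J -> set T) :
  (forall j, 0 <= a j) -> (forall j, measurable (A j)) ->
  ('E_P[fun x => (\sum_j a j * \1_(A j) x)%R] =
   (\sum_j a j * fine (P (A j)))%:E)%E.
Proof.
move=> a0 mA; rewrite expectation_integral.
under eq_integral do rewrite -sumEFin.
rewrite ge0_integral_sum //; last 2 first.
- by move=> j; apply/measurable_EFinP; apply: measurable_funM.
- by move=> j x _; rewrite lee_fin mulr_ge0.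
rewrite -sumEFin; apply: eq_bigr => j _.
under eq_integral do rewrite EFinM.
rewrite ge0_integralZl_EFin //.
- by rewrite integral_indic // setIT EFinM fineK // fin_num_measure.
- exact/measurable_EFinP.
Qed.

(** * Expectations of products over i.i.d. copies *)

Section IidCopies.
Context d0 d (T0 : measurableType d0) (T : measurableType d) (R : realType).
Variables (P0 : probability T0 R) (P : probability T R) (I : finType).
Variables (D : {RV P0 >-> nat}) (X : I -> {RV P >-> nat}).
Hypothesis X_iid : iid_copies D X.

Lemma iid_copies_expectation (f : nat -> R) (i : I) : (forall k, 0 <= f k) ->
  ('E_P[f \o X i] = 'E_P0[f \o D])%E.
Proof.
move=> f0; rewrite !expectation_integral.
have mf : measurable_fun [set: nat] (fun k => (f k)%:E).
  by apply/measurable_EFinP => _ A _.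
have f0' k : (0 <= (f k)%:E)%E by rewrite lee_fin.
rewrite -(ge0_integral_distribution (X i) mf f0').
rewrite -(ge0_integral_distribution D mf f0').
by apply: eq_measure_integral => A mA _; apply: X_iid.2.
Qed.

(** The cut-off at [N] leaves finitely many nonzero values; for nonnegative [f] it increases to [f]
    with [N]. *)
Let trunc (f : nat -> R) N k := if (k < N)%N then f k else 0.

Let trunc_sum (f : nat -> R) N k :
  trunc f N k = \sum_(v < N) f v * \1_[set v : nat] k.
Proof.
rewrite /trunc; case: ltnP => [kN|Nk].
  rewrite (bigD1 (Ordinal kN)) //= indicE mem_set // mulr1 big1 ?addr0 // => v.
  rewrite -val_eqE /= eq_sym => /eqP vk.
  by rewrite indicE memNset ?mulr0.
rewrite big1 // => v _; rewrite indicE memNset ?mulr0 //= => kv.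
by move: Nk; rewrite kv leqNgt ltn_ord.
Qed.

Let expectation_prod_trunc (f : nat -> R) N : (forall k, 0 <= f k) ->
  ('E_P[fun t => (\prod_i trunc f N (X i t))%R] =
   'E_P0[trunc f N \o D] ^+ #|I|)%E.
Proof.
move=> f0.
have mX i (A : set nat) : measurable (X i @^-1` A).
  by rewrite -[_ @^-1` _]setTI; apply: measurable_funPT.
have mD (A : set nat) : measurable (D @^-1` A).
  by rewrite -[_ @^-1` _]setTI; apply: measurable_funPT.
have -> : trunc f N \o D =
    fun t => \sum_(v < N) f v * \1_(D @^-1` [set v : nat]) t.
  by apply/funext => t /=; rewrite trunc_sum.
rewrite expectation_sum_indic //.
(* The joint event that each [X i] equals [g i], in the shape of the product rule of
   [mutually_independent] for the full index set. *)
pose A (g : {ffun I -> 'I_N}) : set T :=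
  [set t | forall i, i \in [set: I]%SET -> [set g i : nat] (X i t)].
have mA g : measurable (A g).
  have -> : A g = \bigcap_(i in [set: I]) (X i @^-1` [set g i : nat]).
    apply/seteqP; split => t /= h i; last by move=> _; apply: h.
    by move=> _; apply: h; rewrite inE.
  by apply: fin_bigcap_measurable.
have -> : (fun t => \prod_i trunc f N (X i t)) =
    fun t => \sum_(g : {ffun I -> 'I_N}) (\prod_i f (g i)) * \1_(A g) t.
  (* Distributing the product of sums gives one term per [g], and the product of its indicators is
     the indicator of [A g]. *)
  apply/funext => t; under eq_bigr do rewrite trunc_sum.
  rewrite bigA_distr_bigA; apply: eq_bigr => g _ /=.
  rewrite big_split /=; congr (_ * _); rewrite indicE.
  case: (boolP (t \in A g)) => [/set_mem tA|/negP tA].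
    by rewrite big1 // => i _; rewrite indicE mem_set //; apply: tA; rewrite inE.
  have [i Xi] : exists i, X i t <> g i.
    apply/existsNP => h; apply: tA; apply/mem_set => i _; exact: h.
  by rewrite (bigD1 i) //= indicE memNset ?mul0r.
rewrite expectation_sum_indic //; last by move=> g; apply: prodr_ge0.
(* The power is a product of equal sums; distributing it too lets independence and equality in law
   match the terms one by one. *)
rewrite -EFin_expe -prodr_const bigA_distr_bigA; congr EFin.
apply: eq_bigr => g _; rewrite big_split /=; congr (_ * _).
rewrite (X_iid.1 [set: I]%SET (fun i => [set g i : nat])) //.
rewrite [in LHS](eq_bigl xpredT) => [|i]; last by rewrite finset.in_setT.
rewrite (eq_bigr (fun i : I => (fine (P0 (D @^-1` [set g i : nat])))%:E)).
  by rewrite prodEFin.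
move=> i _; rewrite fineK ?fin_num_measure //.
exact: (X_iid.2 i [set g i : nat]).
Qed.

(** The truncated products satisfy the bound uniformly in [N], and monotone convergence passes it to
    the limit. The real bound [c] keeps infinite values out of the power. *)
Lemma iid_copies_expectation_prod_le (f : nat -> R) (c : R) :
  (forall k, 0 <= f k) -> ('E_P0[f \o D] <= c%:E)%E ->
  ('E_P[fun t => (\prod_i f (X i t))%R] <= (c ^+ #|I|)%:E)%E.
Proof.
move=> f0 fDc.
have t0 N k : 0 <= trunc f N k by rewrite /trunc; case: ifP.
have tmono k : {homo trunc f ^~ k : N M / (N <= M)%N >-> N <= M}.
  move=> N M NM; rewrite /trunc; case: ltnP => kN; last by case: ifP.
  by rewrite (leq_trans kN NM).
have pmono t : {homo (fun N => (\prod_i trunc f N (X i t))%:E) :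
    N M / (N <= M)%N >-> (N <= M)%E}.
  move=> N M NM; rewrite lee_fin ler_prod // => i _.
  by rewrite t0 tmono.
have mp N : measurable_fun setT (fun t => (\prod_i trunc f N (X i t))%:E).
  apply/measurable_EFinP; apply: measurable_prod => i _.
  exact: (measurable_nat_comp (X i) (trunc f N)).
have -> : ('E_P[fun t => (\prod_i f (X i t))%R] =
    \int[P]_t limn (fun N => (\prod_i trunc f N (X i t))%:E))%E.
  rewrite expectation_integral; apply: eq_integral => t _; apply/esym.
  (* For fixed [t] the truncation has no effect once [N] exceeds every [X i t]. *)
  apply: lim_near_cst => //; exists (\max_i X i t).+1%N => // N /= maxN.
  congr EFin; apply: eq_bigr => i _; rewrite /trunc ifT //.
  by rewrite (leq_trans _ maxN) // ltnS (leq_bigmax i).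
rewrite monotone_convergence //; last first.
  by move=> N t _; rewrite lee_fin prodr_ge0.
apply: lime_le.
  apply: ereal_nondecreasing_is_cvgn => N M NM.
  apply: ge0_le_integral => //.
  - by move=> t _; rewrite lee_fin prodr_ge0.
  - by move=> t _; apply: pmono.
near=> N.
have tDc : ('E_P0[trunc f N \o D] <= c%:E)%E.
  apply: le_trans fDc; apply: expectation_le => //.
  - exact: measurable_nat_comp.
  - exact: measurable_nat_comp.
  - by move=> t /=.
  - by move=> t /=.
  - by apply/aeW => t /=; rewrite /trunc; case: ifP.
rewrite -expectation_integral expectation_prod_trunc //.
have tD0 : (0 <= 'E_P0[trunc f N \o D])%E by apply: expectation_ge0 => t /=.
case: ('E_P0[trunc f N \o D])%E tD0 tDc => // r.
rewrite !lee_fin -EFin_expe lee_fin => r0 rc.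
by apply: lerXn2r => //; rewrite nnegrE // (le_trans r0).
Unshelve. all: by end_near.
Qed.

End IidCopies.

(** * From the pressure to the expected partition function, and the equivalence *)

Lemma annealed_pressure_eqy d (T : measurableType d) (R : realType)
    (P : probability T R) (n : nat) (Deg : 'I_n -> {RV P >-> nat})
    (M : forall t : T, pairing (degrees Deg t)) (beta B : R) : (0 < n)%N ->
  annealed_pressure M beta B = +oo%E <->
  ('E_P[fun t => ising_Z (edges (M t)) beta B] = +oo)%E.
Proof.
move=> n_gt0; have ninv_gt0 : (0 < (n%:R^-1)%:E :> \bar R)%E.
  by rewrite lte_fin invr_gt0 ltr0n.
(* [lne] takes the value +oo only at +oo, and the positive factor 1/n preserves this. *)
rewrite /annealed_pressure; case: expectation.body => [r||] //=.
- split=> // /eqP; rewrite mule_eq_pinfty ninv_gt0 (lt_gtF ninv_gt0) /=.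
  by case: ifP.
- by split=> // _; rewrite gt0_muley.
- by split=> //; rewrite gt0_muleNy.
Qed.

Theorem proposition1p4 (R : realType)
    (d0 : measure_display) (T0 : measurableType d0) (P0 : probability T0 R)
    (D : {RV P0 >-> nat}) (D_ge1 : forall t : T0, (1 <= D t)%N)
    (beta B : R) (beta_ge0 : 0 <= beta)
    (n : nat) (n_gt0 : (0 < n)%N)
    (d : measure_display) (T : measurableType d) (P : probability T R)
    (Deg : 'I_n -> {RV P >-> nat}) (Deg_iid : iid_copies D Deg)
    (M : forall t : T, pairing (degrees Deg t)) (M_unif : uniform_pairing M) :
  annealed_pressure M beta B = +oo%E <->
  ('E_P0[fun t => expR (beta * (D t)%:R / 2)] = +oo)%E.
Proof.
rewrite annealed_pressure_eqy //.
(* Each half-edge carries half the energy of a satisfied edge. *)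
pose f k : R := expR (beta * k%:R / 2).
have f0 k : 0 <= f k by exact: expR_ge0.
have f1 k : 1 <= f k by rewrite -expR0 ler_expR !mulr_ge0 // invr_ge0.
pose Z t := ising_Z (edges (M t)) beta B.
pose F t := \prod_i f (Deg i t).
have mf i : measurable_fun setT (fun t => f (Deg i t)).
  exact: (measurable_nat_comp (Deg i) f).
have mF : measurable_fun setT F by apply: measurable_prod => i _.
have F0 t : 0 <= F t by exact: prodr_ge0.
have mZ : measurable_fun setT Z.
  (* Degrees and pairing are packed into one countable type; the fibres of [W] are the events that
     [uniform_pairing] declares measurable. *)
  pose W t := existT (@pairing n) (degrees Deg t) (M t).
  pose g (w : {dg : {ffun 'I_n -> nat} & pairing dg}) :=
    ising_Z (edges (tagged w)) beta B.
  apply: (@measurable_countable_fibers _ _ _ W _ _ g) => -[dg m].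
  exact: (M_unif dg m).1.
have Z0 t : 0 <= Z t by apply: sumr_ge0 => *; exact: expR_ge0.
pose S t := (\sum_(i < n) Deg i t)%N.
have FE t : F t = expR (beta * (S t)%:R / 2).
  by rewrite natr_sum mulr_sumr mulr_suml expR_sum.
have sizeE t : (size (edges (M t)) * 2 = S t + odd (S t))%N.
  rewrite size_edges //; under eq_bigr do rewrite ffunE.
  by [].
(* Both constants absorb the field; [hi] also counts the configurations and, through [beta / 2], the
   half-edge added for parity. *)
pose lo := expR (- (`|B| * n%:R)).
pose hi : R := #|{ffun 'I_n -> bool}|%:R * expR (beta / 2 + `|B| * n%:R).
have Z_ge t : lo * F t <= Z t.
  apply: le_trans (ising_Z_ge _ _ _).
  rewrite FE /lo -expRD ler_expR addrC lerD2r -mulrA ler_wpM2l //.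
  by rewrite ler_pdivrMr // -natrM sizeE ler_nat leq_addr.
have Z_le t : Z t <= hi * F t.
  apply: le_trans (ising_Z_le _ _ beta_ge0) _.
  have size_le : (size (edges (M t)))%:R <= ((S t)%:R + 1) / 2 :> R.
    by rewrite ler_pdivlMr // -natrM sizeE natr1 ler_nat -addn1 leq_add2l leq_b1.
  rewrite FE /hi -mulrA -expRD ler_wpM2l // ler_expR.
  by have := ler_wpM2l beta_ge0 size_le; lra.
(* As [F] is nonnegative, this also holds when its expectation is infinite. *)
have EcF (c : R) : 0 <= c -> ('E_P[fun t => (c * F t)%R] = c%:E * 'E_P[F])%E.
  move=> c0; rewrite !expectation_integral; under eq_integral do rewrite EFinM.
  rewrite ge0_integralZl_EFin //.
    by move=> t _; rewrite lee_fin.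
  exact/measurable_EFinP.
have lo_ge0 : 0 <= lo by exact: expR_ge0.
have hi_ge0 : 0 <= hi by rewrite mulr_ge0 // expR_ge0.
split=> [EZ|ED].
  change ('E_P0[f \o D] = +oo)%E.
  have ED_ge0 : (0 <= 'E_P0[f \o D])%E by apply: expectation_ge0 => t /=.
  (* Nonnegativity excludes -oo, so only a finite value [r] has to be refuted. *)
  case ED : ('E_P0[f \o D])%E ED_ge0 => [r||] // _.
  have EF : ('E_P[F] <= (r ^+ #|'I_n|)%:E)%E.
    by apply: (iid_copies_expectation_prod_le Deg_iid f0); rewrite ED.
  suff : ('E_P[Z] < +oo)%E by rewrite EZ.
  apply: (@le_lt_trans _ _ ('E_P[fun t => (hi * F t)%R])%E).
    apply: expectation_le => //.
    - exact: measurable_funM.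
    - by move=> t; rewrite mulr_ge0.
    - exact/aeW.
  rewrite EcF // (le_lt_trans (lee_wpmul2l _ EF)) ?lee_fin //.
  by rewrite -EFinM ltry.
(* A vertex exists because [n] is positive; its factor alone already has infinite expectation. *)
pose i0 := Ordinal n_gt0.
have Ff t : f (Deg i0 t) <= F t.
  rewrite /F (bigD1 i0) //= ler_peMr //.
  by apply: (big_ind (fun x => 1 <= x)) => // *; exact: mulr_ege1.
have EF : ('E_P[F] = +oo)%E.
  apply/eqP; rewrite -leye_eq -[leLHS]ED.
  rewrite -[leLHS](iid_copies_expectation Deg_iid i0 f0).
  apply: expectation_le => //.
  - exact: measurable_nat_comp.
  - by move=> t /=.
  - exact/aeW.
apply/eqP; rewrite -leye_eq.
have <- : ('E_P[fun t => (lo * F t)%R] = +oo)%E.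
  by rewrite EcF // EF gt0_muley // lte_fin expR_gt0.
apply: expectation_le => //.
- exact: measurable_funM.
- by move=> t; rewrite mulr_ge0.
- exact/aeW.
Qed.
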